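(* Let $(R,\mathfrak{m})$ be a finite commutative local ring with identity with residue field $\mathbb{F}_q$ of prime characteristic $p$. Let $k\in\mathbb{N}$ with $(k,p)=1$ be such that $k\mid q-1$ and $\frac{q-1}{k}\dagger q-1$. If $\Gamma(k,q)$ is a connected strongly regular graph, then $g_R(k)=2$. In particular, if $(k,q)$ is a semiprimitive pair or an exceptional pair, then $g_R(k)=2$.
   Context: The Waring number $g_R(k)$ is the minimum $s\in\mathbb{N}$, if it exists, such that $x_1^k+\cdots+x_s^k=r$ has a solution in $R$ for every $r\in R$. For $q=p^m$, $n\dagger q-1$ means that $n\mid p^m-1$ and $n\nmid p^a-1$ for all $1\le a<m$. $\Gamma(k,q)=Cay(\mathbb{F}_q,U_k)$ with $U_k=\{x^k:x\in\mathbb{F}_q^*\}$ is the graph with vertex set $\mathbb{F}_q$ and an arc from $v$ to $w$ iff $w-v\in U_k$ (undirected if $U_k=-U_k$). A strongly regular graph with parameters $v,\kappa,e,d$ is an undirected $\kappa$-regular graph with $v$ vertices such that any two distinct adjacent (resp. non-adjacent) vertices have exactly $e\ge0$ (resp. $d\ge0$) common neighbours; connected strongly regular graphs are understood to be those with exactly three distinct eigenvalues (in particular complete graphs are excluded). With $q=p^m$, $(k,q)$ is a semiprimitive pair if $k>1$, $k\ne p^{m/2}+1$, and either $k=2$, $p$ is odd and $m$ is even, or else there is some $\ell$ with $k\mid p^\ell+1$, $\ell\mid m$ and $m/\ell$ even. $(k,q)$ is an exceptional pair if it is one of $(11,3^5)$, $(19,5^9)$, $(35,3^{12})$, $(37,7^9)$,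 $(43,11^7)$, $(67,17^{33})$, $(107,3^{53})$, $(133,5^{18})$, $(163,41^{81})$, $(323,3^{144})$, $(499,5^{249})$. *)

(* Defs.v *)
From HB Require Import structures.
From mathcomp Require Import all_boot all_order all_algebra all_field.

Set Implicit Arguments.
Unset Strict Implicit.
Unset Printing Implicit Defensive.

Import GRing.Theory.
Local Open Scope ring_scope.

(* An [idealr R] is a proper ideal when R is commutative (1 is excluded). *)
Definition maximal_ideal (R : comNzRingType) (M : idealr R) : Prop :=
  forall J : idealr R, {subset M <= J} -> J =i M.

Definition local_ring (R : comNzRingType) (M : idealr R) : Prop :=
  maximal_ideal M /\ (forall N : idealr R, maximal_ideal N -> N =i M).

Definition sums_of_powers_cover (R : nzRingType) (k s : nat) : Prop :=
  forall r : R, exists x : 'I_s -> R, \sum_(i < s) x i ^+ k = r.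

(* g_R(k) = s; a relation, since the minimum need not exist. *)
Definition is_waring_number (R : nzRingType) (k s : nat) : Prop :=
  sums_of_powers_cover R k s /\
  (forall t : nat, sums_of_powers_cover R k t -> (s <= t)%N).

(* n "dagger" p ^ m - 1 *)
Definition dagger (n p m : nat) : Prop :=
  (n %| p ^ m - 1)%N /\
  (forall a : nat, (1 <= a < m)%N -> ~~ (n %| p ^ a - 1)%N).

Definition power_set (F : finFieldType) (k : nat) : {set F} :=
  [set x ^+ k | x in [set x : F | x != 0]].

Definition cayley_graph (V : finZmodType) (S : {set V}) : rel V :=
  fun v w => w - v \in S.

Definition gen_paley (F : finFieldType) (k : nat) : rel F :=
  cayley_graph (power_set F k).
Arguments gen_paley : clear implicits.

Section Graphs.

Variables (V : finType) (E : rel V).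

Definition strongly_regular_with (v kappa e d : nat) : Prop :=
  [/\ symmetric E /\ irreflexive E,
      #|V| = v,
      forall x : V, #|[set y | E x y]| = kappa,
      forall x y : V, x != y -> E x y ->
        #|[set z | E x z && E y z]| = e &
      forall x y : V, x != y -> ~~ E x y ->
        #|[set z | E x z && E y z]| = d].

Definition connected_graph : Prop := forall x y : V, connect E x y.

(* The spectrum of a symmetric integer matrix consists of (real) algebraic
   numbers, so it can be computed in algC. *)
Definition adjacency_matrix : 'M[algC]_#|V| :=
  \matrix_(i, j) (E (enum_val i) (enum_val j))%:R.

Definition three_eigenvalues : Prop :=
  exists s : seq algC,
    [/\ uniq s, size s = 3%N &
        forall a : algC, eigenvalue adjacency_matrix a = (a \in s)].

Definition connected_strongly_regular : Prop :=
  [/\ exists v kappa e d : nat, strongly_regular_with v kappa e d,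
      connected_graph & three_eigenvalues].

End Graphs.

(* A pair (k, q) with q = p ^ m is presented as the triple (k, p, m).  For m odd
   both alternatives fail, so the truncation in m./2 is harmless. *)
Definition semiprimitive_pair (k p m : nat) : Prop :=
  [/\ (1 < k)%N, k <> (p ^ m./2 + 1)%N &
      [/\ k = 2%N, odd p & ~~ odd m] \/
      (exists l : nat, [/\ (k %| p ^ l + 1)%N, (l %| m)%N & ~~ odd (m %/ l)])].

Definition exceptional_pair (k p m : nat) : Prop :=
  (k, p, m) \in
    [:: (11, 3, 5); (19, 5, 9); (35, 3, 12); (37, 7, 9); (43, 11, 7);
        (67, 17, 33); (107, 3, 53); (133, 5, 18); (163, 41, 81);
        (323, 3, 144); (499, 5, 249)]%N.

(* Main.v *)
From HB Require Import structures.
Require Import Defs.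
From mathcomp Require Import all_boot all_order all_algebra all_solvable all_field.
From mathcomp Require Import zify ring lra.
Set Implicit Arguments.
Unset Strict Implicit.
Unset Printing Implicit Defensive.
Import Order.TTheory GRing.Theory Num.Theory.
Local Open Scope ring_scope.

(** Everything is reduced to the residue field F, of order q.

    A Hensel type argument lifts k-th powers from F to R: over a unit residue
    class the k-th power map is injective because k is invertible in F, hence
    it is a bijection onto another class of the same size ([lift_power]).  So
    two k-th powers suffice in R as soon as every element of F is a sum of two
    k-th powers not both zero; for 0 this says that -1 is a k-th power.  One
    k-th power is not enough because k > 1 divides q - 1
    ([waring_number_two]).

    If the Paley graph is connected and strongly regular with parameters
    (v, kappa, e, d), then d > 0: for d = 0, being equal or adjacent would be
    transitive, so the graph would be complete, and a complete graph has at
    most two eigenvalues.  A common neighbour of 0 and r writes r as a sum of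
    two k-th powers ([srg_two_power_sums]).

    For the explicit pairs the sums of two powers are produced directly, without
    Gauss sums and without the strong regularity.

    - If k ^ 4 + 4 <= q, a second moment count of incidences between points and
      lines of the affine plane over F suffices ([two_power_sums_of_large]).
      This settles all exceptional pairs but (11, 3 ^ 5) and (35, 3 ^ 12).

    - In the semiprimitive case k divides Q + 1 with Q = p ^ l and
      q = Q ^ (2 s).  For odd s, k also divides Q ^ s + 1, so that Q may be
      taken to be the square root of q; as k is not Q + 1, the k-th powers
      contain two distinct lines of F over its subfield of order Q
      ([two_power_sums_lines]).  For
      s = 2 the k-th powers contain the elliptic quadric of the elements whose
      norm to the subfield of order Q ^ 2 lies in the subfield of order Q, and
      every vector is a sum of two vectors of that quadric
      ([two_power_sums_quadric]).  For s >= 4 the incidence count applies.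

    - For (11, 3 ^ 5) and (35, 3 ^ 12), 1 + y ^ k runs over representatives of
      all cosets of the group of k-th powers; up to the Frobenius map, this is a
      handful of witnesses checked by computing modulo a factor of a cyclotomic
      polynomial ([two_power_sums_of_cosets]). *)

(** * Finite local rings *)

(** Packs an ideal that is only known inside a proof. *)
Lemma idealr_of_closed (R : nzRingType) (S : {pred R}) :
  idealr_closed S -> exists J : idealr R, J =i S.
Proof.
move=> closedS.
pose mixin := isIdealr.Build R (S : R -> bool) closedS.
by exists (HB.pack_for (idealr R) (S : R -> bool) mixin).
Qed.

(** By finiteness: replace J by a larger proper ideal as long as one exists.
    Candidates are finite sets, so that their existence is decidable. *)
Lemma sub_maximal_ideal (R : finComNzRingType) (J : idealr R) :
  exists2 N : idealr R, maximal_ideal N & {subset J <= N}.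
Proof.
have [n] := ubnP (#|R| - #|J|); elim: n J => // n IHn J.
rewrite ltnS => le_n.
case: (boolP [forall S : {set R}, ~~ ((J \proper S) &&
   [&& 0 \in S, 1 \notin S & [forall a, forall u in S, forall v in S,
      a * u + v \in S]])]) => [/forallP maxJ | /forallPn[S]].
  exists J => // N sJN x; apply/idP/idP; last exact: sJN.
  move=> xN; have := maxJ [set y in N]; rewrite negb_and => /orP[|].
    rewrite properE negb_and negbK => /orP[/subsetPn[y yJ]|/subsetP->//].
      by rewrite inE sJN.
    by rewrite inE.
  case/negP; apply/and3P; split; rewrite ?inE ?idealr0 ?idealr1 //.
  apply/forallP=> a; apply/forall_inP=> u; rewrite inE => uN.
  apply/forall_inP=> v; rewrite !inE => vN.
  by apply: rpredD => //; apply: idealMr.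
rewrite negbK => /andP[ltJS /and3P[S0 S1 /forallP closedS]].
have [|N defN] := @idealr_of_closed R (mem S).
  split=> // a u v uS vS.
  by have /forall_inP/(_ u uS)/forall_inP/(_ v vS) := closedS a.
have cardN : #|N| = #|S| by apply: eq_card.
have ltJN : (#|J| < #|N|)%N by rewrite cardN proper_card.
have [|N' maxN' sNN'] := IHn N.
  apply: leq_trans le_n; rewrite ltn_sub2l //.
  exact: leq_trans ltJN (max_card _).
exists N' => // x xJ; apply: sNN'; rewrite defN.
exact: (subsetP (proper_sub ltJS)).
Qed.

(** The multiples of a non-unit form a proper ideal, which lies in a maximal
    one, and M is the only maximal ideal. *)
Lemma local_unit (R : finComNzRingType) (M : idealr R) (a : R) :
  local_ring M -> a \notin M -> exists b, a * b = 1.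
Proof.
case=> _ uniqM aM.
case: (boolP [exists b, a * b == 1]) => [/existsP[b /eqP ab]|/existsPn inv0].
  by exists b.
have [|J defJ] := @idealr_of_closed R [pred r | [exists s, r == a * s]].
  split=> [||b u v /existsP[s /eqP->] /existsP[t /eqP->]].
  - by apply/existsP; exists 0; rewrite mulr0.
  - by apply/existsPn=> s; rewrite eq_sym.
  by apply/existsP; exists (b * s + t); rewrite mulrDr mulrCA.
have [N maxN sJN] := sub_maximal_ideal J.
case/negP: aM; rewrite -(uniqM N maxN); apply: sJN; rewrite defJ.
by apply/existsP; exists 1; rewrite mulr1.
Qed.

Section Lifting.

Variables (R : finComNzRingType) (M : idealr R) (F : fieldType).
Variable pi : {rmorphism R -> F}.
Hypothesis localM : local_ring M.
Hypothesis kerpi : forall x, (x \in M) = (pi x == 0).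

(** Hensel lifting by counting.  If x and y both reduce to pi a, then
    x ^ k - y ^ k is x - y times an element that reduces to the unit
    k * (pi a) ^ (k - 1); so the k-th power map is injective on the class of a,
    and it maps this class to the equinumerous class of c. *)
Lemma lift_power (k : nat) (a c : R) :
  k%:R != 0 :> F -> pi a != 0 -> pi c = pi a ^+ k -> exists x, x ^+ k = c.
Proof.
move=> k0 a0 pic.
have k_gt0 : (0 < k)%N by case: k k0 {pic} => //; rewrite eqxx.
pose A := [set x | pi x == pi a]; pose C := [set x | pi x == pi c].
have injA : {in A &, injective (fun x : R => x ^+ k)}.
  move=> x y; rewrite !inE => /eqP xa /eqP ya /= /eqP.
  rewrite -subr_eq0 subrXX => /eqP xy0; apply/eqP; rewrite -subr_eq0.
  have [|b sb] := @local_unit R M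
      (\sum_(i < k) x ^+ (k.-1 - i) * y ^+ i) localM.
    rewrite kerpi rmorph_sum (eq_bigr (fun=> pi a ^+ k.-1)) => [|i _].
      by rewrite sumr_const card_ord -mulr_natr mulf_neq0 ?expf_neq0.
    rewrite rmorphM !rmorphXn xa ya -exprD subnK //.
    by rewrite -ltnS prednK.
  by rewrite -[x - y]mulr1 -sb mulrA xy0 mul0r.
have cardAC : #|A| = #|C|.
  rewrite -(card_imset _ (addrI (c - a))); apply: eq_card => x.
  rewrite !inE; apply/imsetP/eqP => [[y]|xc].
    by rewrite inE => /eqP ya ->; rewrite rmorphD rmorphB ya subrK.
  exists (x - (c - a)); last by rewrite [RHS]addrC subrK.
  by rewrite inE 2!rmorphB xc subKr.
have sAC : [set x ^+ k | x in A] \subset C.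
  apply/subsetP=> _ /imsetP[x xA ->]; move: xA; rewrite !inE => /eqP xa.
  by rewrite rmorphXn xa pic.
have : c \in [set x ^+ k | x in A].
  suff -> : [set x ^+ k | x in A] = C by rewrite inE.
  by apply/eqP; rewrite eqEcard sAC (card_in_imset injA) cardAC leqnn.
by case/imsetP=> x _ ->; exists x.
Qed.

End Lifting.

(** * Powers in a finite field *)

(** The clause on -1 writes 0 as a sum of two powers that are units, which is
    what lifting to a local ring requires. *)
Definition two_power_sums (F : nzRingType) (k : nat) : Prop :=
  (exists y : F, y ^+ k = -1) /\
  (forall r : F, exists x y : F, x ^+ k + y ^+ k = r).

Lemma prim_root_neq0 (F : fieldType) (n : nat) (z : F) :
  n.-primitive_root z -> z != 0.
Proof.
move=> zP; apply/eqP=> z0; have /eqP := prim_expr_order zP.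
by rewrite z0 expr0n eqn0Ngt (prim_order_gt0 zP) eq_sym oner_eq0.
Qed.

Section FiniteFieldPowers.

Variable F : finFieldType.

Lemma card_finField_pred : (#|F|.-1).+1 = #|F|.
Proof. exact: ltn_predK (finNzRing_gt1 F). Qed.

Lemma finField_prim_root : exists g : F, (#|F|.-1).-primitive_root g.
Proof.
have gt0 : (0 < #|F|.-1)%N by have := finNzRing_gt1 F; case: #|F| => [|[]].
pose rs := enum (predC1 (0 : F)).
have rs1 : all (#|F|.-1).-unity_root rs.
  apply/allP=> x; rewrite mem_enum /= unity_rootE => x0.
  apply/eqP; apply: (mulfI x0).
  by rewrite -exprS card_finField_pred expf_card mulr1.
have size_rs : (#|F|.-1 <= size rs)%N by rewrite -cardE cardC1.
have /hasP[g _ gP] := has_prim_root gt0 rs1 (enum_uniq _) size_rs.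
by exists g.
Qed.

Variables (k n : nat).
Hypothesis kn : #|F|.-1 = (k * n)%N.

Let kn_gt0 : (0 < k)%N && (0 < n)%N.
Proof.
rewrite -muln_gt0 -kn; have := finNzRing_gt1 F.
by case: #|F| => [|[]].
Qed.

Lemma finField_prim_exp : exists g : F,
  (k * n).-primitive_root g /\ n.-primitive_root (g ^+ k).
Proof.
have [g] := finField_prim_root; rewrite kn => gP; exists g; split=> //.
have /andP[_ n0] := kn_gt0.
by have := dvdn_prim_root gP (dvdn_mull k (dvdnn n)); rewrite mulnK.
Qed.

Lemma unity_root_power (x : F) : x ^+ n = 1 -> exists y, x = y ^+ k.
Proof.
have [g [_ gk]] := finField_prim_exp.
by move=> /(prim_rootP gk)[i ->]; exists (g ^+ i); rewrite exprAC.
Qed.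

Lemma power_unity_root (y : F) : y != 0 -> (y ^+ k) ^+ n = 1.
Proof.
move=> y0; apply: (mulfI y0).
by rewrite -exprM -kn -exprS card_finField_pred expf_card mulr1.
Qed.

(** A generator g is not a k-th power: its order would divide n. *)
Lemma non_power : (1 < k)%N -> exists r : F, forall y, y ^+ k != r.
Proof.
move=> k1; have [g [gP _]] := finField_prim_exp; exists g => y.
apply/eqP=> ykg; have /andP[_ n0] := kn_gt0.
have y0 : y != 0.
  apply/eqP=> y0; move: ykg; rewrite y0 expr0n.
  case: (k) k1 => [|k'] //= _ g0; have := prim_expr_order gP.
  rewrite -g0 expr0n muln_eq0; move: kn_gt0; rewrite !lt0n => /andP[/negPf-> /negPf->].
  by move/eqP; rewrite eq_sym oner_eq0.
have /eqP := power_unity_root y0; rewrite ykg -(prim_order_dvd gP).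
by move/(dvdn_leq n0); rewrite leqNgt -{1}(mul1n n) ltn_mul2r n0 k1.
Qed.

End FiniteFieldPowers.

(** * From the residue field to the local ring *)

(** The summand that is lifted by Hensel's argument has to be a unit, so the
    lemma first arranges that x is nonzero; the other summand is lifted
    arbitrarily, and the first one absorbs the error. *)
Lemma waring_number_two (R : finComNzRingType) (M : idealr R)
    (F : finFieldType) (pi : {rmorphism R -> F}) (k : nat) :
  local_ring M -> (forall x, (x \in M) = (pi x == 0)) ->
  (forall a, exists x, pi x = a) ->
  (1 < k)%N -> (k %| #|F|.-1)%N -> k%:R != 0 :> F ->
  two_power_sums F k -> is_waring_number R k 2.
Proof.
move=> localM kerpi surj k1 /dvdnP[n qn] k0 [[y0 yN1] sums].
have ek : (0 : F) ^+ k = 0 by rewrite expr0n eqn0Ngt (ltnW k1).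
split=> [r|t cover].
  have [x [y [xy x0]]] : exists x y : F, x ^+ k + y ^+ k = pi r /\ x != 0.
    have [r0|r0] := eqVneq (pi r) 0.
      by exists 1, y0; rewrite expr1n yN1 subrr oner_neq0.
    have [x [y xy]] := sums (pi r).
    have [x0|x0] := eqVneq x 0; last by exists x, y.
    exists y, x; rewrite addrC; split=> //; apply: contra r0 => /eqP y0E.
    by rewrite -xy x0 y0E ek addr0.
  have [x' xE] := surj x; have [y' yE] := surj y; subst x y.
  have [|z zE] := lift_power localM kerpi (c := r - y' ^+ k) k0 x0.
    by rewrite rmorphB rmorphXn -xy addrK.
  exists (fun i => if i == ord0 then z else y').
  by rewrite big_ord_recl big_ord1 /= zE subrK.
have qkn : #|F|.-1 = (k * n)%N by rewrite qn mulnC.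
have [a aP] := non_power qkn k1; have [x xa] := surj a.
case: t cover => [|[|t]] // cover.
  have [? ] := cover 1; rewrite big_ord0 => /eqP.
  by rewrite eq_sym oner_eq0.
have [y] := cover x; rewrite big_ord1 => yx.
by have := aP (pi (y ord0)); rewrite -rmorphXn yx xa eqxx.
Qed.

(** * Strongly regular Paley graphs *)

(** A row vector v with entry sum S is mapped by the adjacency matrix J - 1 to
    the vector of entries S - v j; so an eigenvector with eigenvalue a other
    than -1 is constant, and then a = #|V| - 1. *)
Lemma complete_not_three_eigenvalues (V : finType) (E : rel V) :
  (forall x y, E x y = (x != y)) -> ~ three_eigenvalues E.
Proof.
move=> defE [s [uniq_s size_s eig_s]].
suff s2 : {subset s <= [:: -1; #|V|%:R - 1 : algC]}.
  by have := uniq_leq_size uniq_s s2; rewrite size_s.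
move=> a; rewrite -eig_s => /eigenvalueP[v vA v0]; rewrite !inE.
pose S := \sum_j v 0 j.
have vS j : (a + 1) * v 0 j = S.
  have := congr1 (fun w : 'rV_#|V| => w 0 j) vA; rewrite !mxE => avj.
  rewrite mulrDl mul1r -avj /S (bigD1 j) //= [RHS](bigD1 j) //= mxE defE eqxx.
  rewrite mulr0 add0r addrC; congr (_ + _); apply: eq_bigr => i ij.
  by rewrite mxE defE (inj_eq enum_val_inj) ij mulr1.
have [->|a1] := eqVneq a (-1); first by [].
have {}a1 : a + 1 != 0 by rewrite addr_eq0.
have S0 : S != 0.
  apply: contra v0 => /eqP S0; apply/eqP/rowP=> j; rewrite mxE.
  by apply: (mulfI a1); rewrite vS S0 mulr0.
have : (a + 1) * S = #|V|%:R * S.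
  rewrite {1}/S mulr_sumr (eq_bigr (fun=> S)) // sumr_const card_ord.
  by rewrite mulr_natl.
by move/(mulIf S0)=> <-; rewrite addrK eqxx.
Qed.

(** The two cases are d = 0 and d > 0. *)
Lemma connected_srg_complete_or_diameter2 (V : finType) (E : rel V) v kappa e d :
  strongly_regular_with E v kappa e d -> connected_graph E ->
  (forall x y, E x y = (x != y)) \/
  (forall x y, x != y -> ~~ E x y -> exists z, E x z && E y z).
Proof.
case=> -[symE irrE] _ _ _ hd conE.
have [d0|d0] := posnP d; last first.
  right=> x y xy nE; have := hd x y xy nE => card_d.
  have : (0 < #|[set z | E x z && E y z]|)%N by rewrite card_d.
  by case/card_gt0P=> z; rewrite inE => ?; exists z.
left=> x y; apply/idP/idP=> [Exy|xy].
  by apply: contraTneq Exy => ->; rewrite irrE.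
(* For d = 0, being equal or adjacent is a transitive relation. *)
have trE a b c : E a b -> E b c -> (a == c) || E a c.
  move=> Eab Ebc; have [//|ac] := eqVneq a c.
  apply/negPn/negP=> nE; have := hd a c ac nE; rewrite d0 => /eqP.
  by rewrite cards_eq0 => /eqP/setP/(_ b); rewrite !inE Eab symE Ebc.
have /connectP[s] := conE x y.
elim: s x xy => [|z s IHs] x xy /=; first by move=> _ yx; rewrite yx eqxx in xy.
case/andP=> Exz zs lasty.
have [zy|zy] := eqVneq z y; first by rewrite -zy.
by have := trE _ _ _ Exz (IHs z zy zs lasty); rewrite (negPf xy).
Qed.

Lemma srg_two_power_sums (F : finFieldType) (k : nat) :
  (0 < k)%N -> connected_strongly_regular (gen_paley F k) ->
  (1 < k)%N /\ two_power_sums F k.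
Proof.
move=> k0 [[v [kappa [e [d srg]]]] conE three].
have [symE irrE] : symmetric (gen_paley F k) /\ irreflexive (gen_paley F k).
  by case: srg.
have edgeP x y : reflect (exists2 u, u != 0 & y - x = u ^+ k) (gen_paley F k x y).
  apply: (iffP imsetP) => -[u]; first by rewrite inE; exists u.
  by exists u; rewrite ?inE.
have [complete|path] := connected_srg_complete_or_diameter2 srg conE.
  by case: (complete_not_three_eigenvalues complete).
have [y _ y1] : exists2 y : F, y != 0 & -1 = y ^+ k.
  suff /edgeP : gen_paley F k 1 0 by rewrite sub0r.
  rewrite symE; apply/edgeP; exists 1; first exact: oner_neq0.
  by rewrite expr1n subr0.
split.
  rewrite ltn_neqAle k0 andbT; apply/eqP=> k1.
  case: (@complete_not_three_eigenvalues _ (gen_paley F k)) => // x z.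
  apply/edgeP/idP => [[u u0 zxu]|xz].
    by rewrite eq_sym -subr_eq0 zxu expf_neq0.
  by exists (z - x); rewrite -?k1 ?subr_eq0 // eq_sym.
split; first by exists y.
move=> r; have [->|r0] := eqVneq r 0.
  by exists 1, y; rewrite expr1n -y1 subrr.
have [/edgeP[u _]|nE] := boolP (gen_paley F k 0 r).
  by rewrite subr0 => ->; exists u, 0; rewrite expr0n eqn0Ngt k0 addr0.
have [|z /andP[/edgeP[u _ zu]]] := path 0 r _ nE; first by rewrite eq_sym.
rewrite symE => /edgeP[w _ rzw]; exists u, w.
by rewrite -zu -rzw subr0 addrC subrK.
Qed.

(** * Large fields *)

Section Incidences.

Variable F : finFieldType.
Let q := #|F|.

(** The pair y stands for the line of slope y.1 and intercept y.2; vertical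
    lines are left out, whence the inequality in [card_incident2]. *)
Definition incident (x y : F * F) : bool := x.2 == x.1 * y.1 + y.2.

Lemma card_incident (x : F * F) : #|[set y | incident x y]| = q.
Proof.
rewrite /q -[RHS](@card_imset _ _ (fun a => (a, x.2 - x.1 * a))); last first.
  by move=> a b [].
apply: eq_card => -[a b]; rewrite inE; apply/idP/imsetP => [/eqP/= xab|[c _ [-> ->]]].
  by exists a => //; rewrite xab addrC addKr.
by rewrite /incident /= addrC subrK.
Qed.

Lemma card_incident2 (x x' : F * F) : x != x' ->
  (#|[set y | incident x y && incident x' y]| <= 1)%N.
Proof.
case: x x' => [x1 x2] [x1' x2'] xx'; apply/card_le1_eqP => -[a b] [a' b'].
rewrite !inE /incident /= => /andP[/eqP e1 /eqP e2] /andP[/eqP e3 /eqP e4].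
have x1x1' : x1 - x1' != 0.
  rewrite subr_eq0; apply: contra xx' => /eqP x1x1'.
  by rewrite x1x1' e1 e2 x1x1'.
have aa' : a = a'.
  apply: (mulfI x1x1'); rewrite !mulrBl; apply/eqP.
  have -> : x1 * a = x2 - b by rewrite e1 addrK.
  have -> : x1' * a = x2' - b by rewrite e2 addrK.
  have -> : x1 * a' = x2 - b' by rewrite e3 addrK.
  have -> : x1' * a' = x2' - b' by rewrite e4 addrK.
  by apply/eqP; ring.
by congr (_, _) => //; move: e1; rewrite e3 aa' => /addrI.
Qed.

(** Second moment method: over all q ^ 2 lines, the number of points of X on a
    line has mean |X| / q and, since two points share at most one line, total
    square deviation at most q |X|.  Each line of Y misses X and contributes
    (|X| / q) ^ 2.  Multiplying by q ^ 2 keeps the computation in the integers. *)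
Lemma incidence_bound (X Y : {set F * F}) :
  (forall x y, x \in X -> y \in Y -> ~~ incident x y) ->
  (#|X| * #|Y| <= q ^ 3)%N.
Proof.
move=> noinc; have [->|X0] := posnP #|X|; first by [].
pose I (y : F * F) : int := \sum_(x in X) (incident x y)%:R.
have sumI : \sum_y I y = #|X|%:R * q%:R.
  rewrite exchange_big /= (eq_bigr (fun=> q%:R)) => [|x _].
    by rewrite sumr_const mulr_natl.
  rewrite -natr_sum -(card_incident x) -sum1dep_card [in RHS]big_mkcond.
  by congr (_%:R); apply: eq_bigr => y _; case: incident.
have sumI2 : \sum_y I y ^+ 2 <= #|X|%:R ^+ 2 + q%:R * #|X|%:R.
  have -> : \sum_y I y ^+ 2 = \sum_(x in X) \sum_(x' in X)
      (#|[set y | incident x y && incident x' y]|)%:R.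
    under eq_bigr => y _ do rewrite expr2 mulr_suml.
    rewrite exchange_big; apply: eq_bigr => x _ /=.
    under eq_bigr => y _ do rewrite mulr_sumr.
    rewrite exchange_big; apply: eq_bigr => x' _ /=.
    rewrite -sum1dep_card natr_sum [RHS]big_mkcond; apply: eq_bigr => y _.
    by rewrite -natrM mulnb; case: ifP.
  have -> : #|X|%:R ^+ 2 + q%:R * #|X|%:R = \sum_(x in X) (#|X|%:R + q%:R) :> int.
    by rewrite sumr_const -mulr_natl; ring.
  apply: ler_sum => x xX; rewrite (bigD1 x) //= addrC lerD //.
    rewrite -sumr_const.
    rewrite big_mkcondr; apply: ler_sum => x' _; case: ifP => // x'x.
    by rewrite (ler_nat _ _ 1%N) card_incident2 // eq_sym.
  rewrite ler_nat -(card_incident x) subset_leq_card //.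
  by apply/subsetP => y; rewrite !inE andbb.
have var : \sum_y (q%:R * I y - #|X|%:R) ^+ 2 <= q%:R ^+ 3 * #|X|%:R.
  have -> : \sum_y (q%:R * I y - #|X|%:R) ^+ 2 =
     q%:R ^+ 2 * \sum_y I y ^+ 2 - 2 * q%:R * #|X|%:R * \sum_y I y
       + (q%:R * #|X|%:R) ^+ 2.
    have -> : (q%:R * #|X|%:R) ^+ 2 = \sum_(y : F * F) #|X|%:R ^+ 2 :> int.
      rewrite sumr_const (_ : #|xpredT| = (q * q)%N); last first.
        by rewrite -card_prod; apply: eq_card.
      rewrite -[RHS]mulr_natl natrM; ring.
    rewrite !mulr_sumr -sumrB -big_split /=; apply: eq_bigr => y _.
    by ring.
  rewrite sumI; have q2 : 0 <= (q%:R : int) ^+ 2 by rewrite sqr_ge0.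
  have := ler_wpM2l q2 sumI2.
  by set s := \sum_y _; move=> h; nra.
have lower : #|Y|%:R * #|X|%:R ^+ 2 <= \sum_y (q%:R * I y - #|X|%:R) ^+ 2.
  rewrite (bigID (mem Y)) /= -[leLHS]addr0 lerD ?sumr_ge0 // => [|y _]; last first.
    exact: sqr_ge0.
  rewrite mulr_natl -sumr_const; apply: ler_sum => y yY.
  rewrite [I y]big1 ?mulr0 ?sub0r ?sqrrN // => x xX.
  by rewrite (negPf (noinc x y xX yY)).
have := le_trans lower var; rewrite -!natrX -!natrM ler_nat => bound.
rewrite -(leq_pmul2r X0); apply: leq_trans bound.
by rewrite -mulnn mulnCA mulnA.
Qed.

End Incidences.

Section PowerSums.

Variable F : finFieldType.

(** Let U be the group of nonzero k-th powers, of order n = (q - 1) / k.  If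
    u + v = r had no solution in U, then, U being a group, no point (w, r z)
    with w, z in U would lie on a line of slope v and intercept u in U.  The
    incidence bound then gives n ^ 4 <= q ^ 3, that is
    (q - 1) ^ 4 <= k ^ 4 q ^ 3, which is false for q >= k ^ 4 + 4. *)
Lemma two_power_sums_of_large (k : nat) :
  (exists y : F, y ^+ k = -1) -> (k %| #|F|.-1)%N -> (k ^ 4 + 4 <= #|F|)%N ->
  two_power_sums F k.
Proof.
move=> [y0 y0N1] /dvdnP[n qn] large; split; first by exists y0.
have k0 : (0 < k)%N.
  case: k qn {large y0N1} => // /eqP.
  by rewrite muln0 -subn1 subn_eq0 leqNgt finNzRing_gt1.
have qkn : #|F|.-1 = (k * n)%N by rewrite qn mulnC.
have n0 : (0 < n)%N.
  case: n qn {qkn} => // /eqP.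
  by rewrite mul0n -subn1 subn_eq0 leqNgt finNzRing_gt1.
have [g [gP hP]] := finField_prim_exp qkn.
have g0 := prim_root_neq0 gP.
pose U := [set g ^+ k ^+ i | i : 'I_n].
have cardU : #|U| = n.
  rewrite card_imset ?card_ord // => i j /eqP; rewrite (eq_prim_root_expr hP).
  by rewrite !modn_small // => /eqP/val_inj.
have U0 u : u \in U -> u != 0.
  by case/imsetP=> i _ ->; rewrite !expf_neq0.
have UM u v : u \in U -> v \in U -> exists x, x ^+ k = u / v.
  case/imsetP=> i _ -> /imsetP[j _ ->]; exists (g ^+ i / g ^+ j).
  by rewrite expr_div_n !(exprAC g k).
move=> r; have [->|r0] := eqVneq r 0.
  by exists 1, y0; rewrite expr1n y0N1 subrr.
pose X := setX U [set r * z | z in U]; pose Y := setX U U.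
have [/existsP[[w rz]] | none] := boolP [exists x, [exists y,
    [&& x \in X, y \in Y & incident x y]]].
  case/existsP=> -[v u] /and3P[/setXP[wU /imsetP[z zU ->]] /setXP[vU uU]].
  move=> /eqP /= e; have [x xuz] := UM u z uU zU; have [y ywz] := UM w z wU zU.
  case/imsetP: vU => i _ vE; exists x, (y * g ^+ i); rewrite exprMn xuz ywz.
  apply: (mulIf (U0 z zU)); rewrite e vE exprAC; have := U0 z zU.
  by move=> z0; field.
have : (#|X| * #|Y| <= #|F| ^ 3)%N.
  apply: incidence_bound => x y xX yY; apply: contra none => inc.
  by apply/existsP; exists x; apply/existsP; exists y; rewrite xX yY.
rewrite !cardsX card_imset ?cardU; last exact: mulfI.
rewrite -(leq_pmul2l (_ : 0 < k ^ 4)%N) ?expn_gt0 ?k0 // => bound.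
have := leq_mul large (leqnn (#|F| ^ 3)).
(* With t = q - 1, the bounds read t ^ 4 <= k ^ 4 * q ^ 3 and
   (k ^ 4 + 4) * q ^ 3 <= q ^ 4. *)
move: bound; rewrite -card_finField_pred qkn; set t := (k * n)%N => bound h.
have : (t ^ 4 + 4 * t.+1 ^ 3 <= t.+1 * t.+1 ^ 3)%N.
  apply: leq_trans h; rewrite mulnDl leq_add2r; apply: leq_trans bound.
  by rewrite /t expnMn !mulnn -expnM.
have -> : (t ^ 4 + 4 * t.+1 ^ 3 =
           t.+1 * t.+1 ^ 3 + (6 * t ^ 2 + 8 * t + 3))%N by rewrite -addn1; ring.
by rewrite -[leqRHS]addn0 leq_add2l addnS.
Qed.

End PowerSums.

(** * Semiprimitive pairs *)

Section Semiprimitive.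

Variable F : finFieldType.

(** The hypothesis is x ^ (N + 1) = x rather than x ^ N = 1 so that x = 0 is
    covered as well. *)
Lemma unity_root_power_dvd (N K k : nat) (x : F) :
  #|F|.-1 = (N * K)%N -> (k %| K)%N -> x ^+ N.+1 = x -> exists y, x = y ^+ k.
Proof.
move=> qNK /dvdnP[e Kek] xN.
have k0 : (0 < k)%N.
  case: k Kek => //; rewrite muln0 => K0; move/eqP: qNK.
  by rewrite K0 muln0 -subn1 subn_eq0 leqNgt finNzRing_gt1.
have [->|x0] := eqVneq x 0; first by exists 0; rewrite expr0n eqn0Ngt k0.
apply: (@unity_root_power F k (N * e)); first by rewrite qNK Kek mulnA mulnC.
suff -> : x ^+ (N * e) = (x ^+ N) ^+ e.
  by rewrite (_ : x ^+ N = 1) ?expr1n //; apply: (mulfI x0); rewrite -exprS mulr1.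
by rewrite exprM.
Qed.

Variables (p h : nat).
Hypothesis pF : p \in [pchar F].
Let Q := (p ^ h)%N.
Let f (x : F) := x ^+ Q.

Let pcharQ : [pchar F].-nat Q.
Proof. by rewrite pnatX (eq_pnat _ (pcharf_eq pF)) pnat_id ?(pcharf_prime pF). Qed.
Let fD : {morph f : x y / x + y}. Proof. by move=> x y; apply: exprDn_pchar. Qed.
Let fN : {morph f : x / - x}. Proof. by move=> x; apply: exprNn_pchar. Qed.
Let fB : {morph f : x y / x - y}. Proof. by move=> x y; rewrite fD fN. Qed.
Let fM : {morph f : x y / x * y}. Proof. by move=> x y; apply: exprMn. Qed.
Let fV : {morph f : x / x^-1}. Proof. by move=> x; apply: exprVn. Qed.

Let Q0 : (0 < Q)%N.
Proof. by rewrite expn_gt0 prime_gt0 // (pcharf_prime pF). Qed.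

(** The element -1 is fixed by the Frobenius map, and the elements fixed by it
    are (Q + 1)-th powers. *)
Lemma minus_one_power k c :
  #|F|.-1 = (Q.-1 * (Q.+1 * c))%N -> (k %| Q.+1)%N -> exists y : F, y ^+ k = -1.
Proof.
move=> qQ kQ; have [||y ->] := @unity_root_power_dvd _ _ k (-1) qQ.
- exact: dvdn_mulr.
- by rewrite prednK // -/(f _) fN /f expr1n.
by exists y.
Qed.

(** Let K be the subfield of order Q.  Its elements are (Q + 1)-th powers, hence
    k-th powers, and so are their multiples by th = g ^ k, where g generates the
    multiplicative group.  As k is not Q + 1, th lies outside K, so K and th K
    span F.  The decomposition r = a + th b is explicit: applying the Frobenius
    map f gives f r = a + f th b, which determines b and then a. *)
Lemma two_power_sums_lines k :
  #|F| = (Q ^ 2)%N -> (k %| Q.+1)%N -> k <> Q.+1 -> two_power_sums F k.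
Proof.
move=> qQ kQ1 kQ.
have Q1 : (1 < Q)%N.
  have := finNzRing_gt1 F; rewrite qQ; case: (Q) Q0 => [|[]] //.
have qm : #|F|.-1 = (Q.-1 * Q.+1)%N.
  by rewrite qQ -[Q]prednK //= -addn1 -subn1; nia.
split; first by apply: (@minus_one_power k 1); rewrite ?muln1.
have fixed_power a : f a = a -> exists y, a = y ^+ k.
  by move=> fa; apply: (unity_root_power_dvd qm) => //; rewrite prednK.
have [e Qke] := dvdnP kQ1.
have e1 : (1 < e)%N.
  by case: e Qke kQ => [|[]] //; rewrite mul1n => ->.
have qkn : #|F|.-1 = (k * (Q.-1 * e))%N by rewrite qm Qke mulnA mulnC.
have [g [_ hP]] := finField_prim_exp qkn.
have fh : f (g ^+ k) != g ^+ k.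
  have n0 := prim_order_gt0 hP.
  rewrite /f -{2}[g ^+ k]expr1 (eq_prim_root_expr hP) eqn_mod_dvd //.
  have Qp : (0 < Q.-1)%N by rewrite -subn1 subn_gt0.
  rewrite subn1; apply/negP=> /(dvdn_leq Qp); rewrite leqNgt.
  by rewrite -[X in (X < _)%N]muln1 ltn_pmul2l ?e1.
have ff x : f (f x) = x by rewrite /f -exprM mulnn -qQ expf_card.
move=> r; pose b := (f r - r) / (f (g ^+ k) - g ^+ k).
have fb : f b = b.
  by rewrite /b fM fV !fB !ff -(opprB (f r)) -(opprB (f (g ^+ k))) invrN mulrNN.
have [y bE] := fixed_power b fb.
have [|x aE] := fixed_power (r - g ^+ k * b).
  rewrite fB fM fb; apply/eqP; rewrite -subr_eq0; apply/eqP.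
  have : b * (f (g ^+ k) - g ^+ k) = f r - r by rewrite /b mulfVK // subr_eq0.
  move=> e2; transitivity (f r - r - b * (f (g ^+ k) - g ^+ k)); first by ring.
  by rewrite e2 subrr.
by exists x, (g * y); rewrite exprMn -aE -bE subrK.
Qed.

(** Let V be the set of u with u ^ (Q ^ 2 + 1) in the subfield K of order Q.
    Then V consists of (Q + 1)-th powers, and it is the zero set of a quadratic
    form with values in the line of elements z with f z = - z, where f is the
    Q-power Frobenius map.  Its value at r - c u, for u in V and c in K, is
    c L(u) - D(r), where L is K-linear in u and D is the form up to sign.  Both
    L(u) and D(r) lie on that line, so if L(u) is nonzero then c = D(r) / L(u)
    is in K, and r = c u + (r - c u) is the wanted sum.  Some u in V has nonzero
    L(u), because on V the condition L(u) = 0 becomes a polynomial equation of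
    degree less than Q ^ 2, while V has more than Q ^ 2 nonzero elements. *)
Lemma two_power_sums_quadric k :
  #|F| = (Q ^ 4)%N -> (k %| Q.+1)%N -> two_power_sums F k.
Proof.
move=> qQ kQ.
have Q1 : (1 < Q)%N.
  have := finNzRing_gt1 F; rewrite qQ; case: (Q) Q0 => [|[]] //.
have qm : #|F|.-1 = (Q.-1 * (Q ^ 2).+1 * Q.+1)%N.
  by rewrite qQ -[Q]prednK //= -addn1 -subn1; nia.
split.
  by apply: (@minus_one_power k (Q ^ 2).+1) => //; rewrite qm -mulnA [(_ * Q.+1)%N]mulnC.
have f4 x : f (f (f (f x))) = x.
  by rewrite -[RHS]expf_card qQ /f -!exprM !expnS expn0 muln1 ?mulnA.
pose V u := u * f (f u) == f u * f (f (f u)).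
have VP u : V u -> exists y, u = y ^+ k.
  move=> /eqP Vu; apply: (unity_root_power_dvd qm) => //.
  have [->|u0] := eqVneq u 0; first by rewrite expr0n.
  have w0 : u * f (f u) != 0 by rewrite mulf_neq0 // !expf_neq0.
  have wE : u * f (f u) = u ^+ (Q ^ 2).+1 by rewrite /f -exprM mulnn -exprS.
  rewrite exprS mulnC exprM -wE; rewrite -[RHS]mulr1; congr (_ * _).
  apply: (mulfI w0); rewrite mulr1 -exprS prednK //.
  by change (f (u * f (f u)) = u * f (f u)); rewrite fM -Vu.
move=> r; have [->|r0] := eqVneq r 0.
  have [|y yP] := VP 0; first by rewrite /V mul0r /f expr0n eqn0Ngt Q0 /= mul0r.
  by exists y, y; rewrite -yP addr0.
pose L u := f r * f (f (f u)) + f (f (f r)) * f u - r * f (f u) - f (f r) * u.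
have [u Vu Lu] : exists2 u, V u & L u != 0.
  (* On V, f v * f (f (f v)) = v * f (f v); so L v * f v has no term of degree
     Q ^ 3, and dividing it by v * f v leaves P. *)
  pose P : {poly F} := f r *: 'X^(Q ^ 2 - Q) - r *: 'X^(Q ^ 2 - 1)
    + f (f (f r)) *: 'X^(Q - 1) - (f (f r))%:P.
  have QQ : (Q < Q ^ 2)%N by rewrite -{1}[Q]expn1 ltn_exp2l.
  have P0 : P != 0.
    apply/eqP => /(congr1 (horner^~ 0)); rewrite !hornerE !expr0n !subn_eq0.
    rewrite (ltn_geF QQ) (ltn_geF Q1) (ltn_geF (ltn_trans Q1 QQ)) /=.
    rewrite !mulr0 subrr !add0r => /eqP.
    by rewrite oppr_eq0 !expf_eq0 (negPf r0) !andbF.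
  have sizeP : (size P <= Q ^ 2)%N.
    have szX (a : F) i : (i < Q ^ 2)%N -> (size (a *: 'X^i)%R <= Q ^ 2)%N.
      by move=> lti; rewrite (leq_trans (size_scale_leq _ _)) // size_polyXn.
    have szD (p1 p2 : {poly F}) : (size p1 <= Q ^ 2)%N -> (size p2 <= Q ^ 2)%N ->
        (size (p1 + p2)%R <= Q ^ 2)%N.
      by move=> ? ?; rewrite (leq_trans (size_polyD _ _)) // geq_max; apply/andP.
    have Qs : (0 < Q ^ 2)%N by rewrite expn_gt0 Q0.
    apply: (szD _ _); [apply: (szD _ _); [apply: (szD _ _)|]|];
      rewrite ?size_polyN ?szX //.
    - by rewrite ltn_subrL Q0 Qs.
    - by rewrite ltn_subrL Qs.
    - exact: leq_ltn_trans (leq_subr _ _) QQ.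
    by rewrite size_polyC; case: (_ != 0).
  have LP v : V v -> L v * f v = v * f v * P.[v].
    move=> /eqP Vv; rewrite !hornerE.
    have fvB : f v = v * v ^+ (Q - 1) by rewrite -exprS subn1 prednK.
    have ffv : f (f v) = v ^+ (Q ^ 2) by rewrite /f -exprM mulnn.
    have ffvC : f (f v) = v * v ^+ (Q ^ 2 - 1).
      by rewrite ffv -exprS subn1 prednK // expn_gt0 Q0.
    have ffvA : f (f v) = f v * v ^+ (Q ^ 2 - Q) by rewrite ffv /f -exprD subnKC // ltnW.
    transitivity (f r * (f v * f (f (f v))) + f (f (f r)) * (f v * f v)
      - r * (f v * f (f v)) - f (f r) * (v * f v)); first by rewrite /L; ring.
    transitivity (f r * (v * (f v * v ^+ (Q ^ 2 - Q)))
        + f (f (f r)) * (f v * (v * v ^+ (Q - 1)))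
        - r * (f v * (v * v ^+ (Q ^ 2 - 1))) - f (f r) * (v * f v)); last by ring.
    by rewrite -ffvA -fvB -ffvC -Vv.
  have [/existsP[u /andP[Vu Lu]]|noneP] := boolP [exists u, V u && (L u != 0)].
    by exists u.
  have qn : #|F|.-1 = (Q.+1 * (Q.-1 * (Q ^ 2).+1))%N by rewrite qm mulnC.
  have [g [_]] := finField_prim_exp qn; set n := (_ * _.+1)%N; set z := g ^+ _ => zP.
  have root_z i : root P (z ^+ i).
    have zi0 : z ^+ i != 0.
      by rewrite expf_neq0 // (prim_root_neq0 zP).
    have Vz : V (z ^+ i).
      have wE : f (z ^+ i * f (f (z ^+ i))) = z ^+ i * f (f (z ^+ i)).
        have -> : z ^+ i * f (f (z ^+ i)) = (z ^+ i) ^+ (Q ^ 2).+1.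
          by rewrite /f -exprM mulnn -exprS.
        have w1 : (z ^+ i ^+ (Q ^ 2).+1) ^+ Q.-1 = 1.
          by rewrite -[LHS]exprM mulnC -/n exprAC (prim_expr_order zP) expr1n.
        set w := _ ^+ _.+1 in w1 *.
        by rewrite /f -[X in w ^+ X](prednK Q0) exprS w1 mulr1.
      by rewrite /V -{1}wE fM.
    have Lz : L (z ^+ i) = 0.
      apply/eqP; apply: contraNT noneP => Lz.
      by apply/existsP; exists (z ^+ i); rewrite Vz.
    have /eqP := LP _ Vz; rewrite Lz mul0r eq_sym !mulf_eq0 (negPf zi0) /=.
    by rewrite /f expf_eq0 (negPf zi0) andbF.
  pose rs := [seq z ^+ i | i <- iota 0 n].
  have root_rs : all (root P) rs.
    by apply/allP=> _ /mapP[i _ ->]; apply: root_z.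
  have uniq_rs : uniq rs.
    rewrite map_inj_in_uniq ?iota_uniq // => i j; rewrite !mem_iota /= !add0n.
    by move=> ilt jlt /eqP; rewrite (eq_prim_root_expr zP) !modn_small // => /eqP.
  have := max_poly_roots P0 root_rs uniq_rs.
  rewrite size_map size_iota ltnNge (leq_trans sizeP) //.
  by rewrite /n (leq_trans (leqnSn _)) // leq_pmull // -subn1 subn_gt0.
(* f negates both the numerator and the denominator of c. *)
pose c := (f r * f (f (f r)) - r * f (f r)) / L u.
have fc : f c = c.
  rewrite /c fM fV; have -> : f (L u) = - L u.
    by rewrite /L !(fB, fD, fM) !f4; ring.
  have -> : f (f r * f (f (f r)) - r * f (f r)) = - (f r * f (f (f r)) - r * f (f r)).
    by rewrite !(fB, fD, fM) !f4; ring.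
  by rewrite invrN mulrNN.
have [|x xE] := VP (c * u).
  by apply/eqP; rewrite !(fM, fc) mulrACA (eqP Vu) mulrACA.
have [|y yE] := VP (r - c * u).
  rewrite /V !(fB, fM, fc) -subr_eq0; apply/eqP.
  transitivity (c * L u - (f r * f (f (f r)) - r * f (f r))
    + c ^+ 2 * (u * f (f u) - f u * f (f (f u)))).
    by rewrite /L; ring.
  by rewrite (eqP Vu) /c mulfVK // !subrr mulr0 addr0.
by exists x, y; rewrite -xE -yE addrC subrK.
Qed.

End Semiprimitive.

Lemma dvdn_succ_odd_exp a s : odd s -> (a.+1 %| (a ^ s).+1)%N.
Proof.
case: a => [|a] odd_s; first exact: dvd1n.
rewrite -[s]odd_double_half odd_s add1n.
elim: s./2 => [|t IHt]; first by rewrite expn1.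
have e : ((a.+1 ^ t.+1.*2.+1).+1 + a * a.+2 = a.+1 ^ 2 * (a.+1 ^ t.*2.+1).+1)%N.
  by rewrite doubleS !expnS /=; ring.
by rewrite -(dvdn_addl _ (dvdn_mull a (dvdnn a.+2))) e dvdn_mull.
Qed.

(** Lets the condition k ^ 4 + 4 <= q follow from a comparison of bases. *)
Lemma expn4_bound a : (0 < a)%N -> (a ^ 4 + 4 <= a.+1 ^ 4)%N.
Proof.
move=> a0.
have -> : (a.+1 ^ 4 = a ^ 4 + (4 * a ^ 3 + 6 * a ^ 2 + 4 * a + 1))%N.
  by rewrite -addn1; ring.
rewrite leq_add2l (leq_trans _ (leq_addr 1 _)) // (leq_trans _ (leq_addl _ _)) //.
by rewrite leq_pmulr.
Qed.

(** With m = 2 l s and Q = p ^ l, the three cases are s odd, s = 2 and s >= 4.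
    In the last one k + 1 <= Q ^ 2 and q >= Q ^ 8.  The case k = 2 is the
    case l = 1. *)
Lemma semiprimitive_two_power_sums (F : finFieldType) (p m k : nat) :
  prime p -> #|F| = (p ^ m)%N -> (k %| p ^ m - 1)%N ->
  semiprimitive_pair k p m -> two_power_sums F k.
Proof.
move=> pP qF kq [k1 kne pair].
have pF := card_finPcharP qF pP.
have m0 : (0 < m)%N by have := finNzRing_gt1 F; rewrite qF; case: (m).
have [l [kl lm odd_ml]] : exists l, [/\ (k %| p ^ l + 1)%N, (l %| m)%N & ~~ odd (m %/ l)].
  case: pair => [[-> oddp evm]|//]; exists 1%N.
  by rewrite expn1 dvdn2 oddD oddp dvd1n divn1.
have [d md] := dvdnP lm.
have l0 : (0 < l)%N by rewrite lt0n; apply: contraTneq m0 => l0; rewrite md l0 muln0.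
have [s ds] : exists s, d = s.*2.
  exists d./2; rewrite -[LHS]odd_double_half; move: odd_ml.
  by rewrite md mulnK // => /negPf->.
have {d md ds} md : m = (l * s * 2)%N by rewrite md ds -muln2 mulnC mulnA.
rewrite addn1 in kl.
have [odd_s|ev_s] := boolP (odd s).
  apply: (two_power_sums_lines (h := (l * s)%N) pF).
  - by rewrite qF md expnM.
  - by apply: dvdn_trans kl _; rewrite expnM dvdn_succ_odd_exp.
  by move=> kE; apply: kne; rewrite md muln2 doubleK addn1.
have [s2|s2] := eqVneq s 2.
  apply: (two_power_sums_quadric (h := l) pF) => //.
  by rewrite qF md s2 -!expnM -mulnA.
have Q1 : (1 < p ^ l)%N by rewrite -(expn0 p) ltn_exp2l ?prime_gt1.
have s4 : (4 <= s)%N.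
  by move: ev_s s2 m0; rewrite md; case: (s) => [|[|[|[|]]]] //; rewrite muln0.
have [c qQ] : exists c, #|F|.-1 = ((p ^ l).-1 * ((p ^ l).+1 * c))%N.
  have /dvdnP[c cE] := dvdn_pred_predX ((p ^ l) ^ 2) s.
  have Q2 : (((p ^ l) ^ 2).-1 = (p ^ l).-1 * (p ^ l).+1)%N.
    by rewrite -!subn1 -[(p ^ l).+1]addn1 -subn_sqr exp1n.
  by exists c; rewrite qF md mulnAC !expnM cE Q2 [RHS]mulnA mulnC.
apply: two_power_sums_of_large.
- exact: (minus_one_power pF qQ kl).
- by rewrite qF -subn1.
apply: leq_trans (expn4_bound (ltnW k1)) _.
rewrite qF md -mulnA expnM; apply: (@leq_trans ((p ^ l) ^ 8)%N); last first.
  by rewrite leq_pexp2l ?(ltnW Q1) // (leq_mul2r 2 4) s4.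
rewrite [leqRHS](expnM _ 2 4) leq_exp2r //.
have kQ := dvdn_leq (ltn0Sn _) kl.
apply: (@leq_trans (p ^ l + 2)); first by rewrite addn2.
rewrite (@leq_trans (p ^ l * 2)) ?muln2 -?addnn ?leq_add2l //.
by rewrite -mulnn addnn -muln2 leq_mul2l Q1 orbT.
Qed.

(** * Two exceptional pairs in characteristic 3 *)

Section CoefficientLists.

Variable p : nat.

(** Polynomials modulo p as lists of coefficients, constant term first.
    Trailing zeros are allowed: [ceq] compares up to them, and correctness is
    only ever stated through the value [ceval] at a fixed point w. *)
Fixpoint cadd (s t : seq nat) : seq nat :=
  match s, t with
  | a :: s', b :: t' => (a + b) %% p :: cadd s' t'
  | [::], _ => t
  | _, [::] => s
  end%N.

Definition cscale (c : nat) (s : seq nat) : seq nat :=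
  [seq (c * a) %% p | a <- s]%N.

(** Horner's scheme; [red] is applied after each multiplication by X, and is
    either the identity or a reduction. *)
Definition cmul (red : seq nat -> seq nat) (s t : seq nat) : seq nat :=
  foldr (fun a acc => cadd (cscale a t) (red (0%N :: acc))) [::] s.

Definition ceq (s t : seq nat) : bool :=
  all (dvdn p) (cadd s (cscale p.-1 t)).

Definition cXn_sub1 (n : nat) : seq nat := p.-1 :: ncons n.-1 0%N [:: 1%N].

(** Reduction replaces X ^ (size g) by g, i.e. works modulo the monic polynomial
    X ^ (size g) - g. *)
Variable g : seq nat.

Definition cred (s : seq nat) : seq nat :=
  cadd (take (size g) s) (cmul id (drop (size g) s) g).

Definition cexp (s : seq nat) (n : nat) : seq nat :=
  iter n (cmul cred s) [:: 1%N].

Definition cmonic : seq nat := cadd (cscale p.-1 g) (ncons (size g) 0%N [:: 1%N]).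

(** Each (i, y) in ys certifies that (1 + y ^ k) ^ n = w ^ i, where n is the
    product of ns, kept factored to shorten the computation; and the exponents i
    represent all orbits of multiplication by p modulo k. *)
Definition cosets_covered (k : nat) (ns : seq nat)
    (ys : seq (nat * seq nat)) : bool :=
  all (fun iy => ceq (foldl cexp (cadd [:: 1%N] (cexp iy.2 k)) ns)
                     (cexp [:: 0; 1]%N iy.1)) ys &&
  all (fun i => has (fun iy => i \in traject (fun j => j * p %% k)%N iy.1 k) ys)
    (iota 0 k).

Variables (F : fieldType) (w : F).
Hypothesis pF : p \in [pchar F].

Definition ceval (s : seq nat) : F := foldr (fun a acc => a%:R + w * acc) 0 s.

Lemma ceval_add s t : ceval (cadd s t) = ceval s + ceval t.
Proof.
elim: s t => [|a s IHs] [|b t] /=; rewrite ?add0r ?addr0 //.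
by rewrite (GRing.natr_mod_pchar pF) natrD IHs; ring.
Qed.

Lemma ceval_scale c s : ceval (cscale c s) = c%:R * ceval s.
Proof.
elim: s => [|a s IHs] /=; first by rewrite mulr0.
by rewrite (GRing.natr_mod_pchar pF) natrM IHs; ring.
Qed.

Lemma ceval_mul red s t :
  (forall u, ceval (red u) = ceval u) -> ceval (cmul red s t) = ceval s * ceval t.
Proof.
move=> redE; elim: s => [|a s IHs] /=; first by rewrite mul0r.
by rewrite ceval_add ceval_scale redE /= IHs; ring.
Qed.

Lemma ceval_cat s t : ceval (s ++ t) = ceval s + w ^+ size s * ceval t.
Proof.
elim: s => [|a s IHs] /=; first by rewrite expr0; ring.
by rewrite IHs exprS; ring.
Qed.

Lemma pred_p : p.-1%:R = -1 :> F.
Proof.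
have p0 := prime_gt0 (pcharf_prime pF); apply/eqP; rewrite -addr_eq0.
by rewrite natr1 prednK // pcharf0.
Qed.

Lemma ceval_eq s t : ceq s t -> ceval s = ceval t.
Proof.
move=> st; apply/eqP; rewrite -subr_eq0 -[- ceval t]mulN1r -pred_p.
rewrite -ceval_scale -ceval_add; move: st; rewrite /ceq.
elim: (cadd _ _) => //= a u IHu /andP[pa /IHu/eqP->].
by rewrite mulr0 addr0 -(dvdn_pcharf pF).
Qed.

Lemma ceval_Xn_sub1 n : (0 < n)%N -> ceval (cXn_sub1 n) = w ^+ n - 1.
Proof.
case: n => // n _; rewrite /= pred_p addrC exprS; congr (_ * _ - _).
by elim: n => [|n IHn] /=; rewrite ?expr0 ?mulr0 ?addr0 // IHn add0r exprS.
Qed.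

Hypothesis gw : ceval g = w ^+ size g.

Lemma ceval_red s : ceval (cred s) = ceval s.
Proof.
rewrite ceval_add ceval_mul // gw -{3}[s](cat_take_drop (size g)) ceval_cat.
rewrite size_take; case: ltnP => [_|le]; first by rewrite mulrC.
by rewrite drop_oversize //= mul0r mulr0.
Qed.

Lemma ceval_exp s n : ceval (cexp s n) = ceval s ^+ n.
Proof.
elim: n => [|n IHn]; first by rewrite /= mulr0 addr0 expr0.
by rewrite /= ceval_mul ?IHn ?exprS //; apply: ceval_red.
Qed.

Lemma ceval_monic : ceval cmonic = w ^+ size g - ceval g.
Proof.
rewrite ceval_add ceval_scale pred_p mulN1r addrC; congr (_ - _).
elim: (size g) => [|n IHn] /=; first by rewrite mulr0 addr0 expr0.
by rewrite IHn add0r exprS.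
Qed.

(** The Frobenius map turns a witness y for w ^ i into the witness y ^ p for
    w ^ (i p). *)
Lemma cosets_coveredP k ns ys : w ^+ k = 1 -> cosets_covered k ns ys ->
  forall i, (i < k)%N ->
  exists y : F, (1 + y ^+ k) ^+ (\prod_(n <- ns) n) = w ^+ i.
Proof.
move=> wk /andP[/allP cov /allP orbits] i ik.
set N := (\prod_(n <- ns) n)%N.
have foldE s : ceval (foldl cexp s ns) = ceval s ^+ N.
  rewrite /N; elim: (ns) s => [|n l IHl] s /=; first by rewrite big_nil expr1.
  by rewrite IHl ceval_exp big_cons exprM.
have := orbits i; rewrite mem_iota ik => /(_ isT)/hasP[[i0 y0] /cov].
move=> /ceval_eq; rewrite foldE ceval_add !ceval_exp /= !mulr0 !addr0 add0r mulr1.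
move=> y0P /trajectP[j _ ->] {i ik}.
elim: j => [|j [y yP]]; first by exists (ceval y0).
exists (y ^+ p); rewrite iterS expr_mod // exprM -yP.
rewrite [RHS]exprAC [y ^+ p ^+ k]exprAC; congr (_ ^+ N).
by rewrite -!(pFrobenius_autE pF) rmorphD rmorph1.
Qed.

End CoefficientLists.

(** If f1 * f2 * A = (X ^ k - 1) * B, where fi is the monic polynomial
    X ^ (size gi) - gi, then every k-th root of unity w that is not a root of A
    is a root of f1 or of f2. *)
Lemma root_of_factors (p : nat) (F : fieldType) (w : F) (k : nat)
    (g1 g2 A B : seq nat) :
  p \in [pchar F] -> (0 < k)%N -> w ^+ k = 1 -> ceval w A != 0 ->
  ceq p (cmul p id (cmul p id (cmonic p g1) (cmonic p g2)) A)
        (cmul p id (cXn_sub1 p k) B) ->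
  ceval w g1 = w ^+ size g1 \/ ceval w g2 = w ^+ size g2.
Proof.
move=> pF k0 wk A0 /(ceval_eq w pF); rewrite !ceval_mul // !ceval_monic //.
rewrite ceval_Xn_sub1 // wk subrr mul0r => /eqP.
rewrite !mulf_eq0 (negPf A0) orbF !subr_eq0.
by case/orP=> /eqP ->; [left|right].
Qed.

(** The map x |-> x ^ n sends the nonzero elements onto the k-th roots of unity
    with kernel the group of k-th powers.  So if r and 1 + y ^ k have the same
    image, they differ by a factor t ^ k, and r = t ^ k + (t y) ^ k. *)
Lemma two_power_sums_of_cosets (F : finFieldType) (k n : nat) (w : F) :
  #|F|.-1 = (k * n)%N -> odd k -> k.-primitive_root w ->
  (forall i, (i < k)%N -> exists y : F, (1 + y ^+ k) ^+ n = w ^+ i) ->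
  two_power_sums F k.
Proof.
move=> qkn oddk wP cov.
have N1 : (-1 : F) ^+ k = -1 by rewrite -signr_odd oddk expr1.
split=> [|r]; first by exists (-1).
have [->|r0] := eqVneq r 0; first by exists 1, (-1); rewrite expr1n N1 subrr.
have [[i ik] rE] : {i : 'I_k | r ^+ n = w ^+ i}.
  by apply: (prim_rootP wP); rewrite exprAC (power_unity_root qkn).
have [y yP] := cov i ik; have v0 : 1 + y ^+ k != 0.
  apply: contraTneq (prim_root_neq0 wP) => v0; move: yP.
  have n0 : (0 < n)%N.
    move: qkn; case: (n) => // /eqP.
    by rewrite muln0 -subn1 subn_eq0 leqNgt finNzRing_gt1.
  rewrite v0 expr0n eqn0Ngt n0 => /esym/eqP; rewrite expf_eq0 => /andP[_ /eqP->].
  by rewrite eqxx.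
have [|t tE] := @unity_root_power F k n qkn (r / (1 + y ^+ k)).
  rewrite expr_div_n rE yP divff // expf_neq0 //; exact: prim_root_neq0 wP.
exists t, (t * y); rewrite exprMn -tE -{1}[r / _]mulr1 -mulrDr.
by rewrite mulfVK.
Qed.

(** Modulo 3, X ^ 11 - 1 is X - 1 times two quintic factors, the generator
    polynomials of ternary Golay codes; a primitive 11-th root of unity is a root
    of one of them, and both are treated.  Multiplication by 3 modulo 11 has the
    orbits of 0, 1 and 2. *)
Lemma two_power_sums_3_5 (F : finFieldType) :
  #|F| = (3 ^ 5)%N -> two_power_sums F 11.
Proof.
move=> qF; have pF : 3 \in [pchar F] := card_finPcharP qF isT.
have qkn : #|F|.-1 = (22 * 11)%N by rewrite qF.
have [z [_ wP]] := finField_prim_exp qkn; set w := z ^+ _ in wP.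
have w11 := prim_expr_order wP.
apply: (@two_power_sums_of_cosets F 11 22 w) => //.
have -> : 22%N = (\prod_(n <- [:: 2; 11]) n)%N by rewrite !big_cons big_nil.
have A0 : ceval w (cXn_sub1 3 1) != 0.
  by rewrite ceval_Xn_sub1 // subr_eq0 -(prim_order_dvd wP).
have [gw|gw] : ceval w [:: 1; 1; 2; 1; 0]%N = w ^+ 5 \/
    ceval w [:: 1; 0; 2; 1; 2]%N = w ^+ 5.
- by apply: (root_of_factors (B := [:: 1%N]) pF _ w11 A0) => //; vm_compute.
- apply: (cosets_coveredP pF gw w11
    (ys := [:: (0, [:: 1]); (1, [:: 2; 2]); (2, [:: 2; 1; 1; 1])]%N)).
  by vm_compute.
apply: (cosets_coveredP pF gw w11
  (ys := [:: (0, [:: 1]); (1, [:: 2; 1; 1]); (2, [:: 1; 2; 1])]%N)).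
by vm_compute.
Qed.

(** Modulo 3 the cyclotomic polynomial
    (X ^ 35 - 1) (X - 1) / ((X ^ 5 - 1) (X ^ 7 - 1)) is a product of two factors
    of degree 12.  Multiplication by 3 modulo 35 has the orbits of 0, 1, 2, 5
    and 7. *)
Lemma two_power_sums_3_12 (F : finFieldType) :
  #|F| = (3 ^ 12)%N -> two_power_sums F 35.
Proof.
move=> qF; have pF : 3 \in [pchar F] := card_finPcharP qF isT.
pose ns := [:: 16; 13; 73]%N.
have qkn : #|F|.-1 = (\prod_(n <- ns) n * 35)%N.
  rewrite qF -subn1 !big_cons big_nil muln1; lia.
have [z [_ wP]] := finField_prim_exp qkn; set w := z ^+ _ in wP.
have w35 := prim_expr_order wP.
apply: (@two_power_sums_of_cosets F 35 (\prod_(n <- ns) n)%N w) => //.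
  by rewrite qkn mulnC.
have A0 : ceval w (cmul 3 id (cXn_sub1 3 5) (cXn_sub1 3 7)) != 0.
  by rewrite ceval_mul // !ceval_Xn_sub1 // mulf_neq0 // subr_eq0 -(prim_order_dvd wP).
have [gw|gw] :
    ceval w [:: 2; 1; 1; 2; 1; 2; 0; 2; 1; 0; 2; 0]%N = w ^+ 12 \/
    ceval w [:: 2; 0; 2; 0; 1; 2; 0; 2; 1; 2; 1; 1]%N = w ^+ 12.
- by apply: (root_of_factors (B := cXn_sub1 3 1) pF _ w35 A0) => //; vm_compute.
- apply: (cosets_coveredP pF gw w35 (ys := [:: (0, [:: 1]); (1, [:: 2; 1; 1]);
      (2, [:: 2; 0; 1]); (5, [:: 2; 2; 2; 2; 1]); (7, [:: 1; 0; 2])]%N)).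
  by vm_compute.
apply: (cosets_coveredP pF gw w35 (ys := [:: (0, [:: 1]); (1, [:: 2; 1]);
    (2, [:: 2; 0; 1; 0; 1]); (5, [:: 2; 1; 0; 0; 1]); (7, [:: 1; 2; 1])]%N)).
by vm_compute.
Qed.

(** In all cases but (11, 3 ^ 5), (35, 3 ^ 12) and (43, 11 ^ 7), there is an
    exponent j with k < p ^ j and 4 j <= m, whence k ^ 4 + 4 <= p ^ m. *)
Lemma exceptional_two_power_sums (F : finFieldType) (p m k : nat) :
  #|F| = (p ^ m)%N -> (k %| p ^ m - 1)%N -> exceptional_pair k p m ->
  two_power_sums F k.
Proof.
move=> qF kq pair.
have large : odd k -> (k ^ 4 + 4 <= p ^ m)%N -> two_power_sums F k.
  move=> oddk kpm; apply: two_power_sums_of_large; rewrite ?qF -?subn1 //.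
  by exists (-1); rewrite -signr_odd oddk expr1.
have large_exp j : odd k -> (0 < k)%N -> (0 < p)%N -> (k < p ^ j)%N ->
    (j * 4 <= m)%N -> two_power_sums F k.
  move=> oddk k0 p0 kpj jm; apply: large oddk (leq_trans (expn4_bound k0) _).
  by apply: leq_trans (leq_pexp2l p0 jm); rewrite expnM leq_exp2r.
move: pair qF large large_exp {kq}; rewrite /exceptional_pair !in_cons in_nil.
case/or4P=> [|||/or4P[|||/or4P[||| /or3P[||]]]] // /eqP[-> -> ->] qF large large_exp.
(* In each case below, hypotheses that mention the order of the field are
   cleared: matching them against a goal would unfold it in unary. *)
- exact: two_power_sums_3_5.
- by clear qF large; apply: (large_exp 2%N).
- exact: two_power_sums_3_12.
- by clear qF large; apply: (large_exp 2%N).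
- clear qF large_exp; apply: large; first by [].
  apply: leq_trans (@expn4_bound 43 isT) _.
  (* 44 ^ 4 = 4 ^ 4 * 11 ^ 4, and 4 ^ 4 <= 11 ^ 3 *)
  by rewrite (expnMn 4 11 4) (expnD 11 3 4) leq_mul2r orbC.
- by clear qF large; apply: (large_exp 2%N).
- by clear qF large; apply: (large_exp 5%N).
- by clear qF large; apply: (large_exp 4%N).
- by clear qF large; apply: (large_exp 2%N).
- by clear qF large; apply: (large_exp 6%N).
by clear qF large; apply: (large_exp 4%N).
Qed.

Theorem proposition7p3
    (R : finComNzRingType) (M : idealr R) (F : finFieldType)
    (phi : {rmorphism {ideal_quot M} -> F}) (p m k : nat) :
  local_ring M ->
  bijective phi ->
  prime p ->
  #|F| = (p ^ m)%N ->
  coprime k p ->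
  (k %| p ^ m - 1)%N ->
  dagger ((p ^ m - 1) %/ k)%N p m ->
  (connected_strongly_regular (gen_paley F k) -> is_waring_number R k 2%N) /\
  (semiprimitive_pair k p m \/ exceptional_pair k p m -> is_waring_number R k 2%N).
Proof.
move=> localM bij_phi pP qF kp kq _.
have [psi phiK psiK] := bij_phi.
pose pi : {rmorphism R -> F} := phi \o \pi_({ideal_quot M})%qT.
have kerpi x : (x \in M) = (pi x == 0).
  rewrite /pi /= -[X in _ == X](rmorph0 phi) (inj_eq (bij_inj bij_phi)).
  by rewrite -[X in _ == X](rmorph0 \pi_({ideal_quot M})%qT) -Quotient.idealrBE subr0.
have surj a : exists x, pi x = a.
  by exists (repr (psi a)); rewrite /pi /= reprK psiK.
have kq' : (k %| #|F|.-1)%N by rewrite qF -subn1.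
have k0 : (0 < k)%N.
  case: k kq' {kp kq} => //; rewrite dvd0n -subn1 subn_eq0 leqNgt.
  by rewrite finNzRing_gt1.
have kF : k%:R != 0 :> F.
  rewrite -(dvdn_pcharf (card_finPcharP qF pP)) -prime_coprime //.
  by rewrite coprime_sym.
have waring := waring_number_two localM kerpi surj _ kq' kF.
split=> [/(srg_two_power_sums k0)[]//|[semi|exc]]; apply: waring.
- by case: semi.
- exact: semiprimitive_two_power_sums pP qF kq semi.
- move: exc; apply: contraLR; rewrite -leqNgt /exceptional_pair.
  by case: (k) => [|[|]].
exact: exceptional_two_power_sums qF kq exc.
Qed.
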